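(* Let $\mu$ be a self-similar measure in $\mathbb{R}^N$ corresponding to a homogeneous iterated function system $\varphi_i(x) = rO(x) + t_i$, $i \in I$, such that the maps $\varphi_i$ are not all equal. Then for every $k \in \{1,\ldots,N-1\}$ there exists a $k$-dimensional linear space $V \subset \mathbb{R}^N$ such that for every Borel set $Y \subset \mathbb{R}^N$ of full $\mu$-measure, the orthogonal projection $P_V$ onto $V$ is not injective on $Y$.
   Context: Here $I$ is a finite set, $r \in (0,1)$, $O \in \mathbb{R}^{N\times N}$ is an orthogonal matrix and $t_i \in \mathbb{R}^N$ are translation vectors (homogeneous means that $r$ and $O$ do not depend on $i$). A self-similar measure corresponding to $\{\varphi_i : i\in I\}$ is a Borel probability measure $\mu$ in $\mathbb{R}^N$ satisfying $\mu = \sum_{i\in I} p_i\,\varphi_i\mu$ for some strictly positive probability vector $(p_i)_{i\in I}$, where $\varphi_i\mu$ denotes the image (push-forward) of $\mu$ under $\varphi_i$. *)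

(* Defs.v *)
From HB Require Import structures.
From mathcomp Require Import all_boot all_order all_algebra.
From mathcomp Require Import all_classical all_reals all_analysis.

Set Implicit Arguments.
Unset Strict Implicit.
Unset Printing Implicit Defensive.

Import Order.TTheory GRing.Theory Num.Theory.
Import numFieldNormedType.Exports.

Local Open Scope classical_set_scope.
Local Open Scope ring_scope.

(* Points of R^N are row vectors, so that linear subspaces of R^N are row
   spaces of matrices, as in mxalgebra, and the image of the point x under
   the linear map with matrix O (for column vectors) is x *m O^T. *)

(* R^N with its Borel sigma-algebra. *)
Notation borel_rV R N := (g_sigma_algebraType (@open 'rV[R]_N)).

Definition orthogonal_matrix (R : realType) (N : nat) (O : 'M[R]_N) : Prop :=
  O *m O^T = 1%:M.

Definition homogeneous_ifs (R : realType) (N : nat) (I : finType)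
    (r : R) (O : 'M[R]_N) (t : I -> 'rV[R]_N) (i : I) :
    borel_rV R N -> borel_rV R N :=
  fun x : 'rV[R]_N => r *: (x *m O^T) + t i.

Definition self_similar_measure (R : realType) (N : nat) (I : finType)
    (phi : I -> borel_rV R N -> borel_rV R N)
    (mu : probability (borel_rV R N) R) : Prop :=
  exists p : I -> R,
    [/\ forall i, 0 < p i,
        \sum_(i : I) p i = 1 &
        forall A : set (borel_rV R N), measurable A ->
          mu A = (\sum_(i : I) (p i)%:E * pushforward mu (phi i) A)%E].

(* Orthogonal projection onto the row space of V; this is the analogue over R
   of spectral.proj_ortho, which is only available over a numClosedFieldType. *)
Definition orthogonal_projection (R : realType) (N : nat) (V : 'M[R]_N)
    (x : 'rV[R]_N) : 'rV[R]_N :=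
  x *m proj_mx <<V>>%MS (orthomx idfun 1%:M V).

Lemma mulmx_tr_eq0 (R : realType) (N : nat) (v : 'rV[R]_N) :
  v *m v^T = 0 -> v = 0.
Proof.
move=> /matrixP/(_ 0 0); rewrite !mxE => /eqP.
rewrite psumr_eq0 => [/allP v0|i _]; last by rewrite mxE -expr2 sqr_ge0.
apply/rowP => i; have := v0 i (mem_index_enum i).
by rewrite !mxE mulf_eq0 orbb => /eqP.
Qed.

Lemma sub_orthomxP (R : realType) (N : nat) (V : 'M[R]_N) (x : 'rV[R]_N) :
  reflect (forall v : 'rV[R]_N, (v <= V)%MS -> x *m v^T = 0)
    (x <= orthomx idfun 1%:M V)%MS.
Proof.
rewrite /orthomx mul1mx map_mx_id //.
apply: (iffP sub_kermxP) => [xV v /submxP[w ->]|xV].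
  by rewrite trmx_mul mulmxA xV mul0mx.
apply/rowP => i; have /matrixP/(_ 0 0) := xV _ (row_sub i V).
rewrite !mxE => xVi; rewrite -[RHS]xVi.
by apply: eq_bigr => j _; rewrite !mxE.
Qed.

Lemma orthogonal_projectionP (R : realType) (N : nat) (V : 'M[R]_N)
    (x : 'rV[R]_N) :
  (orthogonal_projection V x <= V)%MS /\
  (forall v : 'rV[R]_N, (v <= V)%MS ->
     (x - orthogonal_projection V x) *m v^T = 0).
Proof.
split; first by rewrite (submx_trans (proj_mx_sub _ _ _)) ?genmxE.
apply/sub_orthomxP; apply: proj_mx_compl_sub.
set W := orthomx _ _ _.
rewrite (adds_eqmx (genmxE V) (eqmx_refl W)).
have capVW : (V :&: W)%MS = 0.
  apply/eqP/rowV0P => v; rewrite sub_capmx => /andP[vV /sub_orthomxP vW].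
  exact/mulmx_tr_eq0/vW.
suff : row_full (V + W)%MS by exact: submx_full.
have := mxrank_sum_cap V W; rewrite capVW mxrank0 addn0 => rVW.
rewrite /row_full rVW /W /orthomx mul1mx map_mx_id //.
by rewrite mxrank_ker mxrank_tr subnKC ?rank_leq_row.
Qed.

(* Main.v *)
(* If t_i <> t_j, take V inside the hyperplane orthogonal to v = t_i - t_j.
   Self-similarity with positive weights makes phi_i^-1(Y) and phi_j^-1(Y) of
   full measure, so they share a point x; as the linear parts agree, phi_i(x)
   and phi_j(x) are two points of Y that differ by v, which P_V kills. *)
Require Import Defs.
From mathcomp Require Import all_boot all_order all_algebra.
From mathcomp Require Import all_classical all_reals all_analysis.

Set Implicit Arguments.
Unset Strict Implicit.
Unset Printing Implicit Defensive.

Import Order.TTheory GRing.Theory Num.Theory.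
Import numFieldNormedType.Exports.

Local Open Scope classical_set_scope.
Local Open Scope ring_scope.

(** Balls of row vectors are defined entrywise, and finitely many neighbourhood conditions, one per
    coordinate, can be intersected. *)
Lemma continuous_rV (R : realType) (T : topologicalType) (N : nat)
    (f : T -> 'rV[R]_N) :
  (forall j, continuous (fun x => f x 0 j)) -> continuous f.
Proof.
move=> fc x; apply/cvg_ballP => e e0.
have fj j : \forall y \near x, ball (f x 0 j) e (f y 0 j).
  by move/cvg_ballP : (fc j x); exact.
apply: filterS (filter_forall _ fj) => y yf; split=> // i j; rewrite ord1.
exact: yf.
Qed.

Lemma continuous_affine (R : realType) (T : topologicalType) (m n : nat)
    (f : T -> 'rV[R]_m) (A : 'M[R]_(m, n)) (b : 'rV[R]_n) :
  (forall l, continuous (fun x => f x 0 l)) ->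
  continuous (fun x => f x *m A + b).
Proof.
move=> fc; apply: continuous_rV => j.
rewrite (_ : (fun x => _) = (fun x => (\sum_l f x 0 l * A l j) + b 0 j));
  last by apply/funext => x; rewrite !mxE.
move=> x; apply: cvgD; last exact: cvg_cst.
apply: cvg_big => [|l _]; first exact: add_continuous.
apply: cvgM; last exact: cvg_cst.
exact: fc.
Qed.

Lemma continuous_homogeneous_ifs (R : realType) (N : nat) (I : finType)
    (r : R) (O : 'M[R]_N) (t : I -> 'rV[R]_N) (i : I) :
  continuous (homogeneous_ifs r O t i : 'rV[R]_N -> 'rV[R]_N).
Proof.
rewrite (_ : homogeneous_ifs r O t i = (fun x : 'rV_N => x *m (r *: O^T) + t i)).
  by apply: continuous_affine => l; exact: coord_continuous.
by apply/funext => x; rewrite /homogeneous_ifs scalemxAr.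
Qed.

Lemma measurable_homogeneous_ifs (R : realType) (N : nat) (I : finType)
    (r : R) (O : 'M[R]_N) (t : I -> 'rV[R]_N) (i : I) :
  measurable_fun setT (homogeneous_ifs r O t i).
Proof.
apply: (@measurability _ _ (borel_rV R N) (borel_rV R N) _ _ (@open 'rV[R]_N)) => //.
move=> _ [A oA <-]; rewrite setTI; apply: sub_sigma_algebra.
by move/continuousP: (@continuous_homogeneous_ifs R N I r O t i); exact.
Qed.

(** The witness keeps the first [k] vectors of a basis of [W] and pads them with zero rows to a
    square matrix. *)
Lemma exists_submx_rank (F : fieldType) (m n k : nat) (W : 'M[F]_(m, n)) :
  (k <= \rank W)%N -> exists V : 'M[F]_n, \rank V = k /\ (V <= W)%MS.
Proof.
move=> kW; exists (pid_mx k *m row_base W); split.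
  rewrite mxrankMfree ?row_base_free// rank_pid_mx//.
  exact: leq_trans kW (rank_leq_col W).
by rewrite (submx_trans (submxMl _ _))// eq_row_base.
Qed.

(** The projection of [x] lies in [V], so it is orthogonal to both [x] and
    [x - orthogonal_projection V x], hence to itself. *)
Lemma orthogonal_projection_eq0 (R : realType) (N : nat) (V : 'M[R]_N)
    (x : 'rV[R]_N) :
  (forall v : 'rV[R]_N, (v <= V)%MS -> x *m v^T = 0) ->
  orthogonal_projection V x = 0.
Proof.
move=> xV; have [PV xPV] := orthogonal_projectionP V x.
apply: mulmx_tr_eq0; have := xPV _ PV.
by rewrite mulmxBl xV// sub0r => /eqP; rewrite oppr_eq0 => /eqP.
Qed.

(** A vanishing sum of nonnegative terms has only zero terms, and the weight [p i > 0] can be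
    cancelled. *)
Lemma self_similar_preimage (R : realType) (N : nat) (I : finType)
    (phi : I -> borel_rV R N -> borel_rV R N)
    (mu : probability (borel_rV R N) R) (i : I) (A : set (borel_rV R N)) :
  self_similar_measure phi mu -> measurable A -> mu A = 0%E ->
  mu (phi i @^-1` A) = 0%E.
Proof.
move=> [p [p0 _ muE]] mA; rewrite muE// => /eqP.
rewrite seq_psume_eq0; last first.
  move=> j _; apply: mule_ge0; first by rewrite lee_fin ltW.
  by rewrite /pushforward measure_ge0.
move=> /allP/(_ i (mem_index_enum i)) /=.
by rewrite mule_eq0 eqe gt_eqF//= => /eqP.
Qed.

Theorem proposition1p10 (R : realType) (N : nat) (I : finType)
    (r : R) (O : 'M[R]_N) (t : I -> 'rV[R]_N)
    (mu : probability (borel_rV R N) R)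
    (hr : 0 < r < 1) (hO : orthogonal_matrix O)
    (hmu : self_similar_measure (homogeneous_ifs r O t) mu)
    (hphi : ~ (forall i j : I, homogeneous_ifs r O t i = homogeneous_ifs r O t j)) :
  forall k : nat, (1 <= k <= N.-1)%N ->
    exists V : 'M[R]_N, \rank V = k /\
      forall Y : set (borel_rV R N), measurable Y -> mu Y = 1%E ->
        ~ set_inj Y (orthogonal_projection V).
Proof.
move=> k /andP[_ kN].
have [i [j tij]] : exists i j, t i - t j != 0.
  (* The maps share [r] and [O], so equal translations would make them all equal. *)
  apply: contra_notP hphi => /forallNP tE i j.
  suff tij : t i = t j by rewrite /homogeneous_ifs tij.
  have /forallNP/(_ j)/negP := tE i.
  by rewrite negbK subr_eq0 => /eqP.
set v := t i - t j in tij.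
(* The kernel of [v^T] is the hyperplane orthogonal to [v], of dimension [N - 1] since [v] is
   nonzero. It does not involve [Y], so [V] is fixed before [Y]. *)
have kW : (k <= \rank (kermx v^T))%N.
  by rewrite mxrank_ker mxrank_tr rank_rV tij subn1.
have [V [rV VW]] := exists_submx_rank kW.
exists V; split=> // Y mY Y1 Yinj.
have Pv0 : orthogonal_projection V v = 0.
  apply: orthogonal_projection_eq0 => w /submx_trans/(_ VW)/sub_kermxP wv.
  by apply: trmx_inj; rewrite trmx_mul trmxK wv trmx0.
have Yc0 : mu (~` Y) = 0%E by rewrite probability_setC// Y1 subee.
have Zc0 l : mu (homogeneous_ifs r O t l @^-1` (~` Y)) = 0%E.
  exact: self_similar_preimage hmu (measurableC mY) Yc0.
have mZ l : measurable (homogeneous_ifs r O t l @^-1` (~` Y)).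
  rewrite -[X in measurable X]setTI.
  by apply: measurable_homogeneous_ifs => //; exact: measurableC.
have [x [Yi Yj]] : exists x, Y (homogeneous_ifs r O t i x) /\
    Y (homogeneous_ifs r O t j x).
  (* Otherwise two null sets, the preimages of the complement of [Y], would cover the whole space,
     which has mass 1. *)
  apply: contrapT => /forallNP noY.
  have /eqP := @probability_setT _ _ _ mu.
  have -> : [set: borel_rV R N] = homogeneous_ifs r O t i @^-1` (~` Y) `|`
      homogeneous_ifs r O t j @^-1` (~` Y).
    by apply/seteqP; split=> // x _; apply/not_andP/noY.
  rewrite measureU0; [|exact: mZ|exact: mZ|exact: Zc0].
  by rewrite [X in X == _]Zc0 eq_sym onee_eq0.
have xij : homogeneous_ifs r O t i x - homogeneous_ifs r O t j x = v :> 'rV_N.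
  by rewrite /homogeneous_ifs opprD addrACA subrr add0r.
move/eqP: tij; apply; rewrite -xij; apply/eqP; rewrite subr_eq0; apply/eqP.
apply: Yinj; rewrite ?inE//.
(* By linearity the two projections differ by the projection of [v], which is 0. *)
apply/eqP; rewrite -subr_eq0 /orthogonal_projection -mulmxBl xij.
exact/eqP.
Qed.
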